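(* If an $\mathrm{SCCD}(v,k,b)$ with excess $e$ and an outer expansion set exists, then an $\mathrm{SCCD}(v+2,k,b')$ with $b'=b+\frac{2v}{k-1}+1$ exists with excess $e+k-2$.
   Context: An $\mathrm{SCCD}(v,k,b)$ (linear single change covering design) is a $v$-set $X$ with an ordered list $(B_1,\dots,B_b)$ of $k$-subsets of $X$ with $|B_i\cap B_{i+1}|=k-1$ for $1\le i<b$, such that every pair of elements of $X$ is contained in some block. Its excess is $e=(k-1)b+\binom{k-1}{2}-\binom{v}{2}$. The unchanged subsets are $U_i=B_i\cap B_{i+1}$ for $1\le i\le b-1$; in addition $U_0$ may be any $(k-1)$-subset of $B_1$ and $U_b$ any $(k-1)$-subset of $B_b$. An expansion set is a collection of $\frac{v}{k-1}$ unchanged subsets (distinct indices in $\{0,\dots,b\}$) that are pairwise disjoint with union $X$; it is outer if it contains $U_0$ or $U_b$. *)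

(* Defs.v *)
From mathcomp Require Import all_boot all_order all_algebra.

Set Implicit Arguments.
Unset Strict Implicit.
Unset Printing Implicit Defensive.

(* Blocks are numbered B_1, ..., B_b, as on paper. *)
Definition block (X : finType) (b : nat) (B : b.-tuple {set X}) (i : nat) :
  {set X} := nth set0 B i.-1.

Definition is_SCCD (X : finType) (v k b : nat) (B : b.-tuple {set X}) : Prop :=
  [/\ #|X| = v,
      forall i, 1 <= i <= b -> #|block B i| = k,
      forall i, 1 <= i < b -> #|block B i :&: block B i.+1| = k - 1
    & forall x y : X, x != y ->
        exists2 i, 1 <= i <= b & [set x; y] \subset block B i].

Definition excess (v k b : nat) : int :=
  ((k%:Z - 1) * b%:Z + 'C(k - 1, 2)%:Z - 'C(v, 2)%:Z)%R.

(* [U i] is U_i for 0 <= i <= b; U_0 and U_b are not determined by the blocks,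
   hence a predicate rather than a function of [B]. *)
Definition unchanged_subsets (X : finType) (k b : nat) (B : b.-tuple {set X})
    (U : 'I_b.+1 -> {set X}) : Prop :=
  [/\ U ord0 \subset block B 1 /\ #|U ord0| = k - 1,
      forall i : 'I_b.+1, 1 <= i < b -> U i = block B i :&: block B i.+1
    & U ord_max \subset block B b /\ #|U ord_max| = k - 1].

(* An expansion set is given by its set [S] of indices. When k <= 1 the
   quotient below is 0, so [S] is empty and cannot be outer. *)
Definition expansion_set (X : finType) (k b : nat)
    (U : 'I_b.+1 -> {set X}) (S : {set 'I_b.+1}) : Prop :=
  [/\ k - 1 %| #|X|,
      #|S| = #|X| %/ (k - 1),
      {in S &, forall i j, i != j -> [disjoint U i & U j]}
    & \bigcup_(i in S) U i = [set: X]].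

Definition outer (b : nat) (S : {set 'I_b.+1}) : Prop :=
  ord0 \in S \/ ord_max \in S.

(* Main.v *)
Require Import Defs.
From mathcomp Require Import all_boot all_order all_algebra.
From mathcomp Require Import zify.

(** Add two points [a] and [b]. Next to each unchanged subset [U i] of the
expansion set insert the blocks [U i + a] and [U i + b]; both meet each
neighbour in exactly [U i], and since these [U i] partition the old points, this
covers every pair of an old and a new point. The outer subset sits at an end of
the list, where one further block [U i - x + a + b], with [x] in [U i], can be
attached to cover the pair [a], [b]. *)

(** * Chains of sets and the list form of an SCCD *)

(** Serves to splice runs [G i] of new blocks behind the old blocks [F i]. Consecutive runs are
    glued at the shared [F i.+1]; only the last run has no successor to reach. *)
Lemma path_flatten (T : Type) (e : rel T) (F : nat -> T) (G : nat -> seq T)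
    (m n : nat) :
  (forall i, m <= i < m + n -> path e (F i) (rcons (G i) (F i.+1))) ->
  path e (F (m + n)) (G (m + n)) ->
  path e (F m) (G m ++ flatten [seq F i :: G i | i <- iota m.+1 n]).
Proof.
elim: n m => [|n IHn] m step; first by rewrite addn0 cats0.
rewrite addnS -addSn => stepN.
rewrite /= cat_path /=.
have := step m; rewrite leqnn addnS ltnS leq_addr => /(_ isT).
rewrite rcons_path => /andP[-> ->] /=; apply: IHn => // i /andP[mi iN].
by apply: step; rewrite (ltnW mi) addnS -addSn.
Qed.

Definition adj (T : finType) (k : nat) : rel {set T} :=
  [rel A B : {set T} | #|A :&: B| == k - 1].

(** Trades numbered blocks for [all] and [sorted], which behave well under concatenation and
    reversal. *)
Lemma is_SCCD_tuple (T : finType) (v k b : nat) (B : b.-tuple {set T}) :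
  #|T| = v -> all (fun A : {set T} => #|A| == k) B -> sorted (adj T k) B ->
  (forall x y, x != y -> exists2 A, A \in (B : seq _) & [set x; y] \subset A) ->
  is_SCCD v k B.
Proof.
move=> cT /allP cB /(sortedP set0) adjB cov; split=> //.
- move=> [|i] //= ib; apply/eqP/cB; rewrite /block /=.
  by apply: mem_nth; rewrite size_tuple.
- by move=> [|i] //= ib; apply/eqP/adjB; rewrite size_tuple.
- move=> x y /cov[A AB xyA]; exists (index A B).+1.
    by have := AB; rewrite -index_mem size_tuple.
  by rewrite /block /= nth_index.
Qed.

(** * The two new points and the blocks around one unchanged subset *)

(* The set [A] of old points together with the new points [None], if [a], and
   [Some None], if [b]. *)
Definition lift (X : finType) (A : {set X}) (a b : bool) :
    {set option (option X)} :=
  [set y | match y with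
           | None => a
           | Some None => b
           | Some (Some x) => x \in A
           end].

Lemma card_lift (X : finType) (A : {set X}) (a b : bool) :
  #|lift X A a b| = a + b + #|A|.
Proof.
(* One [option] layer adds one point; this is applied twice below. *)
have card_opt (T : finType) (c : bool) (C : {set T}) :
    #|[set y | if y is Some x then x \in C else c]| = c + #|C|.
  rewrite (cardsD1 None) inE; congr (_ + _).
  rewrite -(card_imset (mem C) (@Some_inj _)); apply: eq_card => -[x|]; rewrite !inE /=.
    by rewrite mem_imset //; exact: Some_inj.
  by apply/esym/imsetP => -[].
rewrite -addnA -card_opt -card_opt; apply: eq_card => -[[x|]|]; by rewrite !inE.
Qed.

Lemma liftI (X : finType) (A B : {set X}) (a b c d : bool) :
  lift X A a b :&: lift X B c d = lift X (A :&: B) (a && c) (b && d).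
Proof. by apply/setP => -[[x|]|]; rewrite !inE. Qed.

(** [c] requests the extra block. It stands last because it is adjacent to [U] plus one new point,
    but shares only [k - 2] points with an old block containing [U]. *)
Definition expansion_blocks (X : finType) (U : {set X}) (x : X) (c : bool) :
    seq {set option (option X)} :=
  [:: lift X U true false, lift X U false true
    & nseq c (lift X (U :\ x) true true)].

Lemma path_expansion (X : finType) (k : nat) (A U : {set X}) (x : X) (c : bool) :
  1 < k -> U \subset A -> #|U| = k - 1 -> c ==> (x \in U) ->
  path (adj _ k) (lift X A false false) (expansion_blocks X U x c).
Proof.
move=> k1 UA cU; rewrite /adj /= !liftI (setIidPr UA) setIid !card_lift /= cU eqxx.
case: c => //= xU; rewrite liftI (setIidPr (subD1set _ _)) card_lift /=.
by have := cardsD1 x U; rewrite xU cU => /eqP; lia.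
Qed.

Lemma all_card_expansion (X : finType) (k : nat) (U : {set X}) (x : X) (c : bool) :
  1 < k -> #|U| = k - 1 -> c ==> (x \in U) ->
  all (fun A : {set option (option X)} => #|A| == k) (expansion_blocks X U x c).
Proof.
move=> k1 cU; rewrite /= !card_lift cU.
have -> : true + false + (k - 1) == k by lia.
case: c => //= xU; rewrite !card_lift.
by have := cardsD1 x U; rewrite xU cU => /eqP; lia.
Qed.

(** The two points add [2v + 1] pairs, while [2q + 1] further blocks contribute
    [(2q + 1)(k - 1) = 2v + k - 1]; the difference is [k - 2]. *)
Lemma excess_expand (v k b q : nat) :
  0 < k -> v = q * (k - 1) ->
  excess (v + 2) k (b + 2 * q + 1) = (excess v k b + k%:Z - 2)%R.
Proof.
move=> k0 vq; rewrite /excess.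
have -> : 'C(v + 2, 2) = 'C(v, 2) + v + v.+1 by rewrite addn2 !binS !bin1 bin0; lia.
have -> : (k%:Z = (k - 1)%:Z + 1)%R by lia.
by rewrite vq; nia.
Qed.

(** * The enlarged list of blocks *)

Section Expansion.

Variables (X : finType) (k b : nat) (B : b.-tuple {set X}).
Variables (U : 'I_b.+1 -> {set X}) (S : {set 'I_b.+1}) (i0 : 'I_b.+1) (x0 : X).

(* The blocks inserted after [B_i], or before [B_1] if [i = 0]; the additional
   block comes with [i0]. *)
Definition inserted (i : nat) : seq {set option (option X)} :=
  let j := inord i : 'I_b.+1 in
  let s := if j \in S then expansion_blocks X (U j) x0 (j == i0) else [::] in
  if i == 0 then rev s else s.

Definition expanded : seq {set option (option X)} :=
  inserted 0 ++
  flatten [seq lift X (block B i) false false :: inserted i | i <- iota 1 b].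

Lemma size_expanded : i0 \in S -> size expanded = b + 2 * #|S| + 1.
Proof.
move=> i0S; rewrite size_cat size_flatten /shape -map_comp sumnE big_map.
have -> : iota 1 b = index_iota 1 b.+1 by rewrite /index_iota subSS subn0.
under eq_bigr => i _ do rewrite /= -add1n.
rewrite big_split /= sum_nat_const_nat muln1 subSS subn0 addnCA -addnA.
(* The run ahead of [B_1] becomes the term [i = 0], so the sum ranges over all of ['I_b.+1]. *)
congr (_ + _); rewrite -(big_ltn (F := fun i => size (inserted i))) // big_mkord.
have sz (i : 'I_b.+1) :
    size (inserted i) = if i \in S then 2 + (i == i0) else 0.
  by rewrite /inserted inord_val; case: (i \in S); case: ifP; rewrite ?size_rev //=
     size_nseq.
rewrite (eq_bigr _ (fun i _ => sz i)) -big_mkcond big_split /= sum_nat_const mulnC.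
by congr (_ + _); rewrite (bigD1 i0) //= eqxx big1 // => i /andP[_ /negbTE->].
Qed.

Lemma mem_inserted (i : 'I_b.+1) (A : {set option (option X)}) :
  A \in inserted i = (i \in S) && (A \in expansion_blocks X (U i) x0 (i == i0)).
Proof. by rewrite /inserted inord_val; case: (i \in S); case: ifP; rewrite ?mem_rev. Qed.

Lemma mem_expanded_inserted (i : 'I_b.+1) (A : {set option (option X)}) :
  A \in inserted i -> A \in expanded.
Proof.
move=> Ai; rewrite mem_cat; case: (posnP i) Ai => [-> -> // | i_gt0 Ai].
apply/orP; right; apply/flatten_mapP; exists (i : nat).
  by rewrite mem_iota i_gt0 add1n ltn_ord.
by rewrite inE Ai orbT.
Qed.

Lemma mem_expanded_block (i : nat) :
  1 <= i <= b -> lift X (block B i) false false \in expanded.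
Proof.
move=> ib; rewrite mem_cat; apply/orP; right; apply/flatten_mapP; exists i.
  by rewrite mem_iota add1n ltnS.
by rewrite inE eqxx.
Qed.

Hypotheses (k1 : 1 < k) (b0 : 0 < b) (BP : is_SCCD #|X| k B).
Hypotheses (UP : unchanged_subsets k B U) (x0U : x0 \in U i0).

Lemma card_unchanged (i : 'I_b.+1) : #|U i| = k - 1.
Proof.
case: UP => -[_ U0] Ui [_ Ub]; case: BP => _ _ adjB _.
case: (posnP i) => [i_0 | i_gt0].
  by have -> : i = ord0 by apply: val_inj.
have := ltn_ord i; rewrite ltnS leq_eqVlt => /orP[/eqP ib | ib].
  by have -> : i = ord_max by apply: val_inj.
by rewrite Ui ?i_gt0 // adjB ?i_gt0.
Qed.

Lemma unchanged_sub_block (i : 'I_b.+1) : 0 < i -> U i \subset block B i.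
Proof.
case: UP => _ Ui [Ub _] i_gt0.
have := ltn_ord i; rewrite ltnS leq_eqVlt => /orP[/eqP ib | ib].
  by have -> : i = ord_max by apply: val_inj.
by rewrite Ui ?i_gt0 // subsetIl.
Qed.

Lemma unchanged_sub_blockS (i : 'I_b.+1) : i < b -> U i \subset block B i.+1.
Proof.
case: UP => -[U0 _] Ui _ ib; case: (posnP i) => [i_0 | i_gt0].
  by rewrite i_0; have -> : i = ord0 by apply: val_inj.
by rewrite Ui ?i_gt0 // subsetIr.
Qed.

Lemma x0_imply (i : 'I_b.+1) : (i == i0) ==> (x0 \in U i).
Proof. by apply/implyP => /eqP->. Qed.

Lemma all_card_expanded :
  all (fun A : {set option (option X)} => #|A| == k) expanded.
Proof.
have ins (i : 'I_b.+1) :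
    all (fun A : {set option (option X)} => #|A| == k) (inserted i).
  apply/allP => A; rewrite mem_inserted => /andP[_]; move: A; apply/allP.
  by apply: all_card_expansion; rewrite ?card_unchanged ?x0_imply.
rewrite all_cat (ins ord0) /=; apply/allP => A /flatten_mapP[i].
rewrite mem_iota add1n ltnS => ib; rewrite inE => /orP[/eqP-> | Ai].
  by rewrite card_lift; case: BP => _ /(_ i ib)->.
have ib' : i < b.+1 by case/andP: ib.
exact: (allP (ins (Ordinal ib'))).
Qed.

Lemma path_inserted (i : 'I_b.+1) :
  0 < i -> path (adj _ k) (lift X (block B i) false false) (inserted i).
Proof.
move=> i_gt0; rewrite /inserted inord_val gtn_eqF //; case: ifP => // iS.
apply: path_expansion; rewrite ?card_unchanged ?x0_imply //.
exact: unchanged_sub_block.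
Qed.

Hypothesis i0P : i0 = ord0 \/ i0 = ord_max.

Lemma path_inserted_rcons (i : 'I_b.+1) : 0 < i < b ->
  path (adj _ k) (lift X (block B i) false false)
    (rcons (inserted i) (lift X (block B i.+1) false false)).
Proof.
move=> /andP[i_gt0 ib]; rewrite rcons_path path_inserted //=.
rewrite /inserted inord_val gtn_eqF //.
(* An inner run lacks the extra block, as [i0] is an end index. So either it ends in [U i] plus one
   new point, or it is empty and two old neighbours meet directly. *)
have /negbTE-> : i != i0 by case: i0P => ->; rewrite -val_eqE /=; lia.
case: ifP => _; rewrite /adj /= liftI card_lift /=.
  by rewrite (setIidPl _) ?card_unchanged // unchanged_sub_blockS.
by case: BP => _ _ -> //; rewrite i_gt0.
Qed.

Lemma sorted_expanded : sorted (adj _ k) expanded.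
Proof.
have symA : symmetric (adj (option (option X)) k) by move=> A C; rewrite /adj /= setIC.
(* The run ahead of [B_1] is stored reversed; read outwards from [B_1] it has the usual order, and
   symmetry of [adj] turns it back. *)
have head : path (adj _ k) (lift X (block B 1) false false) (rev (inserted 0)).
  rewrite /inserted /= revK; have -> : inord 0 = ord0 :> 'I_b.+1.
    by apply: val_inj; rewrite /= inordK.
  case: ifP => // _; apply: path_expansion; rewrite ?card_unchanged ?x0_imply //.
  exact: unchanged_sub_blockS.
have tail : path (adj _ k) (lift X (block B 1) false false)
    (inserted 1 ++ flatten [seq lift X (block B i) false false :: inserted i
                           | i <- iota 2 b.-1]).
  apply: (path_flatten _ _ (fun i => lift X (block B i) false false)).
    move=> i; rewrite add1n prednK // => ib.
    have ib' : i < b.+1 by case/andP: ib => _ /ltnW.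
    exact: (path_inserted_rcons (Ordinal ib')).
  by rewrite add1n prednK //; exact: (path_inserted ord_max).
have iotaE : iota 1 b = 1 :: iota 2 b.-1 by rewrite -{1}(prednK b0).
rewrite /expanded iotaE /=.
have sHead : sorted (adj _ k) (rcons (inserted 0) (lift X (block B 1) false false)).
  by rewrite -rev_sorted rev_rcons /= (eq_path (e' := adj _ k)).
case: (inserted 0) sHead => [|A s] //=.
by rewrite rcons_path cat_path /= => /andP[-> ->].
Qed.

Lemma expanded_covers :
  i0 \in S -> \bigcup_(i in S) U i = [set: X] ->
  forall x y, x != y -> exists2 A, A \in expanded & [set x; y] \subset A.
Proof.
move=> i0S UT.
have covU x : exists2 i, i \in S & x \in U i.
  by have := in_setT x; rewrite -UT => /bigcupP[i iS xi]; exists i.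
have covN x : exists2 A, A \in expanded & [set None; Some (Some x)] \subset A.
  have [i iS xi] := covU x; exists (lift X (U i) true false).
    by apply: (mem_expanded_inserted i); rewrite mem_inserted iS !inE eqxx.
  by rewrite subUset !sub1set !inE.
have covSN x : exists2 A, A \in expanded & [set Some None; Some (Some x)] \subset A.
  have [i iS xi] := covU x; exists (lift X (U i) false true).
    by apply: (mem_expanded_inserted i); rewrite mem_inserted iS !inE eqxx orbT.
  by rewrite subUset !sub1set !inE.
(* Only the extra block at [i0] contains both new points. *)
have covNN : exists2 A, A \in expanded & [set None; Some None] \subset A.
  exists (lift X (U i0 :\ x0) true true).
    by apply: (mem_expanded_inserted i0); rewrite mem_inserted i0S !inE mem_nseq !eqxx !orbT.
  by rewrite subUset !sub1set !inE.
(* Pairs naming the new points in the other order follow by [setUC]; what remains is a pair of old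
   points, covered by an old block. *)
case=> [[x|]|] [[y|]|] // xy; do ?[by []
  | by rewrite setUC; first [exact: covN | exact: covSN | exact: covNN]].
have [_ _ _ /(_ x y)[//|i ib]] := BP.
rewrite subUset !sub1set => /andP[xi yi].
exists (lift X (block B i) false false); first exact: mem_expanded_block.
by rewrite subUset !sub1set !inE xi.
Qed.

End Expansion.

Theorem theorem4 (v k b : nat) (e : int) :
  (exists (X : finType) (B : b.-tuple {set X}) (U : 'I_b.+1 -> {set X})
          (S : {set 'I_b.+1}),
     [/\ is_SCCD v k B, excess v k b = e, unchanged_subsets k B U,
         expansion_set k U S & outer S]) ->
  forall b' : nat, b' = b + (2 * v) %/ (k - 1) + 1 ->
  exists (Y : finType) (B' : b'.-tuple {set Y}),
    is_SCCD (v + 2) k B' /\ excess (v + 2) k b' = (e + k%:Z - 2)%R.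
Proof.
move=> [X [B [U [S [BP <- UP [kX cS _ UT] oS]]]]] b' ->.
have cX : #|X| = v by case: BP.
rewrite -{v}cX in BP *.
have [i0 i0S i0P] : exists2 i0, i0 \in S & i0 = ord0 \/ i0 = ord_max.
  by case: oS => ?; [exists ord0 | exists ord_max] => //; [left | right].
(* For [k <= 1] the quotient by [k - 1 = 0] is 0, but [S] contains [i0]. *)
have k1 : 1 < k.
  have: 0 < #|S| by apply/card_gt0P; exists i0.
  by rewrite cS; case: (k) => [|[|]].
(* For [b = 0] the default value [set0] of [block B 1] would have to contain the nonempty
   [U ord0]. *)
have b0 : 0 < b.
  case: UP => -[U0 cU0] _ _; have := subset_leq_card U0.
  rewrite cU0 /block; case: (b) B {BP U0} => [|//] B.
  by rewrite tuple0 /= cards0; lia.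
have [x0 x0U] : exists x0, x0 \in U i0.
  by apply/card_gt0P; rewrite (card_unchanged X k b B) //; lia.
(* Divisibility of [#|X|] by [k - 1] lets the factor 2 leave the quotient. *)
have -> : 2 * #|X| %/ (k - 1) = 2 * #|S| by rewrite cS muln_divA.
have /eqP sz := size_expanded X b B U S i0 x0 i0S.
exists (option (option X)), (Tuple sz); split; last first.
  by apply: excess_expand; [exact: ltnW | rewrite cS divnK].
apply: is_SCCD_tuple => /=.
- by rewrite !card_option addn2.
- exact: all_card_expanded.
- exact: sorted_expanded.
- exact: (expanded_covers X k).
Qed.
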